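(* Let $A\in\mathcal{V}(I)$, let $\alpha:G\curvearrowright A$ be a generalized partial action of $G$ on the algebra $A$, and let the global action $\theta:G\curvearrowright\Omega(A)$ and the map $\nu:A\to\Omega(A)$ be as defined in the context. Then $(\theta,\nu)$ is a universal global action of $\alpha$; that is, for every global action $\beta:G\curvearrowright X$ on an algebra $X\in\mathcal{V}(I)$ and every $G$-equivariant map $\psi:A\to X$, there exists a unique $G$-equivariant map $\widetilde\psi:\Omega(A)\to X$ such that $\widetilde\psi\circ\nu=\psi$.
   Context: $K$ is an associative commutative unital ring, all modules, algebras and tensor products are over $K$, and $G$ is a group. A non-associative algebra is a $K$-module with a $K$-bilinear product, not necessarily associative or unital. $F(X)$ is the free non-associative (non-unital) $K$-algebra on a countable set; for $I\subseteq F(X)$, $\mathcal{V}(I)$ is the class (a category with algebra homomorphisms) of all non-associative algebras satisfying all identities $f=0$, $f\in I$. A generalized partial action $\alpha:G\curvearrowright A$ of $G$ on an algebra $A\in\mathcal{V}(I)$ consists of subalgebras $A_g\subseteq A$ and algebra isomorphisms $\alpha_g:A_{g^{-1}}\to A_g$ ($g\in G$) such that $A_1=A$, $\alpha_1=\mathrm{id}$; $\alpha_g(A_{g^{-1}}\cap A_{g^{-1}h})\subseteq A_g\cap A_h$; and $\alpha_g\alpha_h(x)=\alpha_{gh}(x)$ for $x\in A_{h^{-1}}\cap A_{h^{-1}g^{-1}}$. It is global if all $A_g=A$. A $G$-equivariant map from $\alpha:G\curvearrowright A$ to $\beta:G\curvearrowright B$ is an algebra homomorphism $\phi:A\to B$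 with $\phi(A_g)\subseteq B_g$ and $\phi(\alpha_g(x))=\beta_g(\phi(x))$ for all $g\in G$, $x\in A_{g^{-1}}$. $\Lambda(A)$ is the quotient of the $K$-module $KG\otimes A$ by the submodule generated by all $g\otimes\alpha_h(a)-gh\otimes a$ ($g,h\in G$, $a\in A_{h^{-1}}$); $\lfloor g,a\rfloor$ is the class of $g\otimes a$. Put $\Theta_g(\lfloor h,a\rfloor)=\lfloor gh,a\rfloor$ and $\iota:A\to\Lambda(A)$, $\iota(a)=\lfloor 1,a\rfloor$. For a $K$-module $M$, $F_I(M)\in\mathcal{V}(I)$ with linear map $j:M\to F_I(M)$ is the free algebra generated by $M$ in $\mathcal{V}(I)$: for each $B\in\mathcal{V}(I)$ and each linear map $\phi:M\to B$ there is a unique algebra homomorphism $\widehat\phi:F_I(M)\to B$ with $\widehat\phi\circ j=\phi$. Let $\widetilde\Theta:G\curvearrowright F_I(\Lambda(A))$ be the unique global action by algebra automorphisms with $\widetilde\Theta_g\circ j=j\circ\Theta_g$. Let $J$ be the ideal of $F_I(\Lambda(A))$ generated by all $j(\lfloor g,a\rfloor)j(\lfloor g,b\rfloor)-j(\lfloor g,ab\rfloor)$, $a,b\in A$, $g\in G$; it is $\widetilde\Theta$-invariant. Set $\Omega(A)=F_I(\Lambda(A))/J$ with projection $p$, let $\theta:G\curvearrowright\Omega(A)$ be the global action with $\theta_g\circ p=p\circ\widetilde\Theta_g$, and let $\nu=p\circ j\circ\iota:A\to\Omega(A)$ (a $G$-equivariant algebra homomorphism). *)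

(* Defs.v *)
From HB Require Import structures.
From mathcomp Require Import all_boot all_algebra.
From mathcomp Require Import finmap boolp classical_sets functions cardinality fsbigop.

Set Implicit Arguments.
Unset Strict Implicit.
Unset Printing Implicit Defensive.

Import GRing.Theory.

Local Open Scope classical_set_scope.
Local Open Scope ring_scope.
Local Open Scope quotient_scope.

Reserved Notation "x ** y" (at level 40, left associativity).

Section Submodules.
Context {K : pzRingType} {M : lmodType K}.

Definition submodule (N : set M) :=
  N 0 /\ forall a x y, N x -> N y -> N (a *: x + y).

Record submod := Submod {
  submod_set :> M -> Prop;
  submodP : submodule submod_set
}.

Lemma smallest_submodule S : submodule (smallest submodule S).
Proof.
split=> [N [[]]//|a x y Sx Sy N SN].
by have [[_ lN] _] := SN; apply: lN; [exact: Sx|exact: Sy].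
Qed.

Definition submod_gen (S : set M) : submod := Submod (smallest_submodule S).

Lemma sub_submod_gen S x : S x -> submod_gen S x.
Proof. exact: sub_gen_smallest. Qed.

(* Boolean version of membership, as required by Quotient.quot *)
Definition mem_submod (N : submod) : {pred M} := fun x => `[< N x >].

Lemma mem_submodE N x : (x \in mem_submod N) = `[< N x >].
Proof. by []. Qed.

Lemma mem_submod_closed N : submod_closed (mem_submod N).
Proof.
case: N => N [N0 NL]; split; rewrite ?mem_submodE; first exact/asboolP.
by move=> a x y; rewrite !mem_submodE => /asboolP ? /asboolP ?; exact/asboolP/NL.
Qed.

Lemma submodZ (N : submod) a x : N x -> N (a *: x).
Proof. by case: N => N [N0 NL] /= Nx; rewrite -[_ *: _]addr0; exact: NL. Qed.

Lemma submodD (N : submod) x y : N x -> N y -> N (x + y).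
Proof. by case: N => N [N0 NL] /= Nx; rewrite -[x]scale1r; exact: NL. Qed.

Lemma submodN (N : submod) x : N x -> N (- x).
Proof. by rewrite -scaleN1r; exact: submodZ. Qed.

HB.instance Definition _ N :=
  GRing.isSubmodClosed.Build K M (mem_submod N) (mem_submod_closed N).

End Submodules.
Arguments submod {K} M.

Lemma linear0_of (K : pzRingType) (M V : lmodType K) (f : M -> V) :
  linear f -> f 0 = 0.
Proof. by move=> /(_ (-1) 0 0); rewrite !scaleN1r !addNr. Qed.

Lemma linear_kernel_submodule (K : pzRingType) (M V : lmodType K) (f : M -> V) :
  linear f -> submodule [set x | f x = 0].
Proof.
move=> lf; split=> [|a x y /= fx fy]; first exact: linear0_of.
by rewrite lf fx fy scaler0 addr0.
Qed.

Lemma linear_eq_submodule (K : pzRingType) (M V : lmodType K) (f g : M -> V) :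
  linear f -> linear g -> submodule [set x | f x = g x].
Proof.
move=> lf lg; split=> [|a x y /= fx fy]; first by rewrite /= !linear0_of.
by rewrite lf lg fx fy.
Qed.

Lemma linearD_of (K : pzRingType) (M V : lmodType K) (f : M -> V) :
  linear f -> {morph f : x y / x - y}.
Proof.
move=> lf x y; rewrite -scaleN1r [x + _]addrC lf.
by rewrite scaleN1r addrC.
Qed.

Lemma linear_comp (K : pzRingType) (M V W : lmodType K)
  (f : V -> W) (g : M -> V) : linear f -> linear g -> linear (f \o g).
Proof. by move=> lf lg a x y /=; rewrite lg lf. Qed.

Section QuotientModule.
Context {K : pzRingType} {M : lmodType K} (N : submod M).

Definition quotmod := Quotient.quot (mem_submod N).

HB.instance Definition _ := GRing.Zmodule.on quotmod.
HB.instance Definition _ : EqQuotient M (Quotient.equiv (mem_submod N)) quotmod :=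
  EqQuotient.on quotmod.

Definition quotpi (x : M) : quotmod := \pi_quotmod x.

Lemma quotpi_eq x y : (quotpi x = quotpi y) <-> N (x - y).
Proof.
split=> [/eqmodP|Nxy]; first by rewrite /= Quotient.equivE => /asboolP.
by apply/eqmodP; rewrite /= Quotient.equivE; apply/asboolP.
Qed.

Lemma quotpi_surj (u : quotmod) : exists x, u = quotpi x.
Proof. by exists (repr u); rewrite /quotpi reprK. Qed.

Lemma quotpi_repr x : N (repr (quotpi x) - x).
Proof. by apply/quotpi_eq; rewrite /quotpi reprK. Qed.

Lemma quotpiD x y : quotpi (x + y) = quotpi x + quotpi y.
Proof. exact: Quotient.pi_add. Qed.

Definition quot_scale a (u : quotmod) : quotmod := quotpi (a *: repr u).

Lemma quotpiZ a x : quotpi (a *: x) = quot_scale a (quotpi x).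
Proof.
by apply/quotpi_eq; rewrite -scalerBr; apply: submodZ; rewrite -opprB; apply/submodN/quotpi_repr.
Qed.

Lemma quot_scaleA a b u : quot_scale a (quot_scale b u) = quot_scale (a * b) u.
Proof. by have [x ->] := quotpi_surj u; rewrite -!quotpiZ scalerA. Qed.
Lemma quot_scale1 : left_id 1 quot_scale.
Proof. by move=> u; have [x ->] := quotpi_surj u; rewrite -!quotpiZ scale1r. Qed.
Lemma quot_scaleDr : right_distributive quot_scale +%R.
Proof.
move=> a u v; have [x ->] := quotpi_surj u; have [y ->] := quotpi_surj v.
by rewrite -quotpiD -!quotpiZ -quotpiD scalerDr.
Qed.
Lemma quot_scaleDl u : {morph quot_scale^~ u : a b / a + b}.
Proof.
by move=> a b; have [x ->] := quotpi_surj u; rewrite -!quotpiZ -quotpiD scalerDl.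
Qed.

HB.instance Definition _ := GRing.Zmodule_isLmodule.Build K quotmod
  quot_scaleA quot_scale1 quot_scaleDr quot_scaleDl.

Lemma quotpi_linear : linear quotpi.
Proof. by move=> a x y; rewrite quotpiD quotpiZ. Qed.

Lemma quotpi0 x : N x -> quotpi x = 0.
Proof.
move=> Nx; rewrite -(linear0_of quotpi_linear).
by apply/quotpi_eq; rewrite subr0.
Qed.

(* Only meaningful when f is linear and vanishes on N, see quot_liftE *)
Definition quot_lift {V : Type} (f : M -> V) (u : quotmod) : V := f (repr u).

Lemma quot_liftE (V : lmodType K) (f : M -> V) : linear f ->
  (forall x, N x -> f x = 0) -> forall x, quot_lift f (quotpi x) = f x.
Proof.
move=> lf f0 x; apply/eqP; rewrite -subr_eq0 -(linearD_of lf).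
by rewrite f0 //; exact: quotpi_repr.
Qed.

Lemma quot_lift_linear (V : lmodType K) (f : M -> V) : linear f ->
  (forall x, N x -> f x = 0) -> linear (quot_lift f).
Proof.
move=> lf f0 a u v; have [x ->] := quotpi_surj u; have [y ->] := quotpi_surj v.
by rewrite -quotpi_linear !(quot_liftE lf f0) lf.
Qed.

End QuotientModule.

(* The free module on T consists of the finitely supported functions. *)
Section FreeModule.
Context (K : pzRingType) (T : choiceType).

Definition supp (f : T -> K) : set T := [set x | f x != 0].

Definition finsupp : {pred T -> K^o} := fun f => `[< finite_set (supp f) >].

Lemma finsuppP f : reflect (finite_set (supp f)) (f \in finsupp).
Proof. exact: asboolP. Qed.

Lemma finsupp_closed : submod_closed finsupp.
Proof.
split.
  by apply/finsuppP; apply: sub_finite_set (finite_set0 _) => x; rewrite /supp /= eqxx.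
move=> a f g /finsuppP Ff /finsuppP Fg; apply/finsuppP.
apply: (@sub_finite_set _ _ (supp f `|` supp g)); last by rewrite finite_setU.
move=> x; rewrite /supp /= => /eqP; apply: contra_notP => /not_orP[].
move=> /negP/negPn/eqP fx /negP/negPn/eqP gx.
by have -> : (a *: f + g) x = a * f x + g x by []; rewrite fx gx mulr0 addr0.
Qed.

HB.instance Definition _ :=
  GRing.isSubmodClosed.Build K (T -> K^o) finsupp finsupp_closed.

Record freemod := FreeMod { freemod_val : T -> K^o; _ : freemod_val \in finsupp }.

HB.instance Definition _ := [isSub for freemod_val].
HB.instance Definition _ := [Choice of freemod by <:].
HB.instance Definition _ := [SubChoice_isSubLmodule of freemod by <:].

Definition coef (f : freemod) : T -> K := freemod_val f.
Coercion coef : freemod >-> Funclass.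

Lemma freemodP (f g : freemod) : f =1 g -> f = g.
Proof. by move=> fg; apply: val_inj; apply/funext. Qed.

Lemma freemod_finite (f : freemod) : finite_set (supp f).
Proof. exact/finsuppP/(valP f). Qed.

Arguments coef : simpl never.

Lemma freemodE a (f g : freemod) x : (a *: f + g) x = a * f x + g x.
Proof. by []. Qed.

Fact delta_finsupp (t : T) : (fun x => (x == t)%:R : K^o) \in finsupp.
Proof.
apply/finsuppP; apply: (@sub_finite_set _ _ [set t]); last exact: finite_set1.
by move=> x; rewrite /supp /=; have [->//|_] := eqVneq x t; rewrite eqxx.
Qed.

Definition delta (t : T) : freemod := FreeMod (delta_finsupp t).

Lemma deltaE t x : delta t x = (x == t)%:R.
Proof. by []. Qed.

Lemma delta_supp t : supp (delta t) `<=` [set t].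
Proof.
by move=> x; rewrite /supp /= deltaE; have [->//|_] := eqVneq x t; rewrite eqxx.
Qed.

Context {V : lmodType K}.

Definition freemod_lift (phi : T -> V) (f : freemod) : V :=
  \sum_(x \in supp f) f x *: phi x.

Lemma freemod_liftE phi (f : freemod) (D : set T) : finite_set D ->
  supp f `<=` D -> freemod_lift phi f = \sum_(x \in D) f x *: phi x.
Proof.
move=> finD fD; apply: fsbig_widen => // x [_ /= /negP/negPn/eqP ->].
by rewrite scale0r.
Qed.

Lemma freemod_lift_linear phi : linear (freemod_lift phi).
Proof.
move=> a f g; pose D := supp f `|` supp g.
have finD : finite_set D by rewrite finite_setU; split; exact: freemod_finite.
have fgD : supp (a *: f + g) `<=` D.
  move=> x; apply: contraPP => /not_orP[] /negP/negPn/eqP fx /negP/negPn/eqP gx.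
  by apply/negP/negPn/eqP; rewrite freemodE fx gx mulr0 addr0.
rewrite !(@freemod_liftE phi _ D) //; [|by move=> x ?; right|by move=> x ?; left].
rewrite !fsbig_finite //= scaler_sumr -big_split /=.
by apply: eq_bigr => x _; rewrite freemodE scalerDl scalerA.
Qed.

Lemma freemod_lift_delta phi t : freemod_lift phi (delta t) = phi t.
Proof.
rewrite (freemod_liftE _ (finite_set1 t) (@delta_supp t)).
by rewrite fsbig_set1 deltaE eqxx scale1r.
Qed.

End FreeModule.

Lemma freemod_decomp (K : pzRingType) (T : choiceType) (f : freemod K T) :
  f = freemod_lift (@delta K T) f.
Proof.
have fin := freemod_finite f; rewrite /freemod_lift fsbig_finite //=.
apply: freemodP => x.
have -> (s : seq T) : (\sum_(i <- s) f i *: delta K i) x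
    = \sum_(i <- s) f i * (x == i)%:R.
  by elim: s => [|t s IH]; rewrite ?big_nil // !big_cons -IH.
have [/eqP fx0|fx] := boolP (f x == 0).
  rewrite fx0 big1 // => i _; have [<-|_] := eqVneq x i; last by rewrite mulr0.
  by rewrite fx0 mul0r.
have xs : x \in fset_set (supp f) by rewrite in_fset_set // inE.
rewrite (big_rem x xs) /= eqxx mulr1 big1_seq ?addr0 // => i /andP[_].
rewrite mem_rem_uniq ?fset_uniq // inE => /andP[ix _].
by rewrite eq_sym (negPf ix) mulr0.
Qed.

Lemma freemod_ind (K : pzRingType) (T : choiceType) (P : set (freemod K T)) :
  submodule P -> (forall t, P (delta K t)) -> forall f, P f.
Proof.
move=> [P0 PD] Pd f; rewrite (freemod_decomp f) /freemod_lift.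
rewrite fsbig_finite; last exact: freemod_finite.
by elim: (X in \sum_(_ <- X) _) => [|t s IH]; rewrite ?big_nil// big_cons; apply: PD.
Qed.

Lemma freemod_ext (K : pzRingType) (T : choiceType) (V : lmodType K)
  (f g : freemod K T -> V) : linear f -> linear g ->
  (forall t, f (delta K t) = g (delta K t)) -> f =1 g.
Proof. by move=> lf lg; exact: (freemod_ind (linear_eq_submodule lf lg)). Qed.

Section Tensor.
Context {K : pzRingType} (M N : lmodType K).

Inductive tensor_rel : set (freemod K (M * N)%type) :=
| tensor_rel_l a x x' y : tensor_rel
    (delta K (a *: x + x', y) - (a *: delta K (x, y) + delta K (x', y)))
| tensor_rel_r a x y y' : tensor_rel
    (delta K (x, a *: y + y') - (a *: delta K (x, y) + delta K (x, y'))).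

Definition tensor := quotmod (submod_gen tensor_rel).
HB.instance Definition _ := GRing.Lmodule.on tensor.

Definition tens (x : M) (y : N) : tensor := quotpi _ (delta K (x, y)).

Lemma tens_linearl y : linear (tens^~ y).
Proof.
move=> a x x'; rewrite /tens -quotpi_linear; apply/quotpi_eq.
by apply: sub_submod_gen; apply: tensor_rel_l.
Qed.

Lemma tens_linearr x : linear (tens x).
Proof.
move=> a y y'; rewrite /tens -quotpi_linear; apply/quotpi_eq.
by apply: sub_submod_gen; apply: tensor_rel_r.
Qed.

Lemma tensor_ext (V : lmodType K) (f g : tensor -> V) : linear f -> linear g ->
  (forall x y, f (tens x y) = g (tens x y)) -> f =1 g.
Proof.
move=> lf lg fg u; have [w ->] := quotpi_surj u.
have lp := quotpi_linear (submod_gen tensor_rel).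
by move: w; apply: (freemod_ext (linear_comp lf lp) (linear_comp lg lp)) => -[].
Qed.

Context {V : lmodType K}.

(* Only meaningful when f is bilinear, see tensor_lift_tens *)
Definition tensor_lift (f : M -> N -> V) : tensor -> V :=
  quot_lift (freemod_lift (fun p : M * N => f p.1 p.2)).

Variable f : M -> N -> V.
Hypothesis lfl : forall y, linear (f^~ y).
Hypothesis lfr : forall x, linear (f x).

Let f_rel x : submod_gen tensor_rel x -> freemod_lift (fun p => f p.1 p.2) x = 0.
Proof.
have lF := freemod_lift_linear (fun p : M * N => f p.1 p.2).
apply: (smallest_sub (linear_kernel_submodule lF)) => {x} _ [] a x *.
  by rewrite /= (linearD_of lF) lF !freemod_lift_delta /= lfl subrr.
by rewrite /= (linearD_of lF) lF !freemod_lift_delta /= lfr subrr.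
Qed.

Lemma tensor_lift_linear : linear (tensor_lift f).
Proof. exact: quot_lift_linear (freemod_lift_linear _) f_rel. Qed.

Lemma tensor_lift_tens x y : tensor_lift f (tens x y) = f x y.
Proof.
by rewrite /tensor_lift (quot_liftE (freemod_lift_linear _) f_rel)
  freemod_lift_delta.
Qed.

End Tensor.

HB.mixin Record Lmodule_hasBilinearMul (K : comPzRingType) A
    of GRing.Lmodule K A := {
  nmul : A -> A -> A;
  nmul_linearl : forall y, linear (nmul^~ y);
  nmul_linearr : forall x, linear (nmul x)
}.

#[short(type="nalgType")]
HB.structure Definition NAlgebra (K : comPzRingType) :=
  {A of GRing.Lmodule K A & Lmodule_hasBilinearMul K A}.

Notation "x ** y" := (nmul x y) : ring_scope.

Definition nalg_hom (K : comPzRingType) (A B : nalgType K) (f : A -> B) :=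
  linear f /\ {morph f : x y / x ** y >-> x ** y}.

Lemma nalg_hom_comp (K : comPzRingType) (A B C : nalgType K)
  (f : B -> C) (g : A -> B) : nalg_hom f -> nalg_hom g -> nalg_hom (f \o g).
Proof.
move=> [lf mf] [lg mg]; split; first exact: linear_comp.
by move=> x y /=; rewrite mg mf.
Qed.

Section Ideals.
Context {K : comPzRingType} {A : nalgType K}.

Definition subalgebra (S : set A) :=
  submodule S /\ forall x y, S x -> S y -> S (x ** y).

Definition nideal (S : set A) :=
  submodule S /\ forall x y, S x -> S (x ** y) /\ S (y ** x).

Record ideal := Ideal { ideal_submod :> submod A; idealP : nideal ideal_submod }.

Lemma smallest_ideal S : nideal (smallest nideal S).
Proof.
split; first split=> [N [[[]]]//|a x y Sx Sy N SN].
  by have [[[_ lN] _] _] := SN; apply: lN; [exact: Sx|exact: Sy].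
by move=> x y Sx; split=> N SN; have [[_ /(_ x y (Sx _ SN))[]]] := SN.
Qed.

Definition ideal_gen (S : set A) : ideal :=
  @Ideal (Submod (smallest_ideal S).1) (smallest_ideal S).

Lemma sub_ideal_gen S x : S x -> ideal_gen S x.
Proof. exact: sub_gen_smallest. Qed.

Lemma ideal_gen_sub S (N : set A) : nideal N -> S `<=` N -> ideal_gen S `<=` N.
Proof. exact: smallest_sub. Qed.

End Ideals.
Arguments ideal {K} A.

Lemma nalg_hom_kernel (K : comPzRingType) (A B : nalgType K) (f : A -> B) :
  nalg_hom f -> nideal [set x | f x = 0].
Proof.
move=> [lf mf]; split=> [|x y /= fx]; first exact: linear_kernel_submodule.
rewrite !mf fx; split; last exact: (linear0_of (nmul_linearr _)).
exact: (linear0_of (nmul_linearl (f y))).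
Qed.

Section QuotientAlgebra.
Context {K : comPzRingType} {A : nalgType K} (J : ideal A).

Definition quotalg := quotmod J.
HB.instance Definition _ := GRing.Lmodule.on quotalg.

Definition quotalg_pi : A -> quotalg := quotpi J.

Definition quot_mul (u v : quotalg) : quotalg := quotalg_pi (repr u ** repr v).

Lemma quotalg_pi_mul x y :
  quotalg_pi (x ** y) = quot_mul (quotalg_pi x) (quotalg_pi y).
Proof.
apply/esym/quotpi_eq; set x' := repr _; set y' := repr _.
have Jx : J (x' - x) := quotpi_repr J x.
have Jy : J (y' - y) := quotpi_repr J y.
have -> : x' ** y' - x ** y = (x' - x) ** y' + x ** (y' - y).
  by rewrite (linearD_of (nmul_linearl _)) (linearD_of (nmul_linearr _)) addrA subrK.
have [_ JM] := idealP J.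
by apply: submodD; [exact: (JM _ _ Jx).1|exact: (JM _ _ Jy).2].
Qed.

Lemma quot_mul_linearl v : linear (quot_mul^~ v).
Proof.
move=> a u u'; have [x ->] := quotpi_surj u; have [x' ->] := quotpi_surj u'.
have [y ->] := quotpi_surj v.
by rewrite -quotpi_linear -!quotalg_pi_mul nmul_linearl /quotalg_pi quotpi_linear.
Qed.

Lemma quot_mul_linearr u : linear (quot_mul u).
Proof.
move=> a v v'; have [x ->] := quotpi_surj v; have [x' ->] := quotpi_surj v'.
have [y ->] := quotpi_surj u.
by rewrite -quotpi_linear -!quotalg_pi_mul nmul_linearr /quotalg_pi quotpi_linear.
Qed.

HB.instance Definition _ := Lmodule_hasBilinearMul.Build K quotalg
  quot_mul_linearl quot_mul_linearr.

Lemma quotalg_pi_hom : nalg_hom quotalg_pi.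
Proof. by split; [exact: quotpi_linear|exact: quotalg_pi_mul]. Qed.

Lemma quotalg_surj (u : quotalg) : exists x, u = quotalg_pi x.
Proof. exact: quotpi_surj. Qed.

Lemma quotalg_pi0 x : J x -> quotalg_pi x = 0.
Proof. exact: quotpi0. Qed.

Lemma quotalg_liftE (B : nalgType K) (f : A -> B) : nalg_hom f ->
  (forall x, J x -> f x = 0) ->
  forall x, quot_lift f (quotalg_pi x) = f x.
Proof. by case=> lf _; exact: quot_liftE. Qed.

Lemma quotalg_lift_hom (B : nalgType K) (f : A -> B) : nalg_hom f ->
  (forall x, J x -> f x = 0) -> nalg_hom (quot_lift f : quotalg -> B).
Proof.
move=> hf f0; have [lf mf] := hf; split; first exact: quot_lift_linear.
move=> u v; have [x ->] := quotalg_surj u; have [y ->] := quotalg_surj v.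
by rewrite -quotalg_pi_hom.2 !(quotalg_liftE hf f0) mf.
Qed.

End QuotientAlgebra.

Inductive magma (T : Type) := Leaf of T | Node of magma T & magma T.

HB.instance Definition _ T := gen_eqMixin (magma T).
HB.instance Definition _ T := gen_choiceMixin (magma T).

(* Free non-associative algebra on T: the free module on the free magma.  Since
   a magma element factors in at most one way, the bilinear extension of Node
   is computed coefficientwise. *)
Section FreeNAlgebra.
Context (K : comPzRingType) (T : Type).

Definition free_nalg := freemod K (magma T).
HB.instance Definition _ := GRing.Lmodule.on free_nalg.

Definition free_mul_coef (f g : free_nalg) (m : magma T) : K^o :=
  match m with Leaf _ => 0 | Node l r => f l * g r end.

Fact free_mul_finsupp f g : free_mul_coef f g \in @finsupp K (magma T).
Proof.
apply/finsuppP.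
apply: (@sub_finite_set _ _ ((fun p => Node p.1 p.2) @` (supp f `*` supp g))).
  move=> [t|l r]; rewrite /supp /= ?eqxx // => fg; exists (l, r) => //=.
  split; apply: contra_neq fg => ->; by rewrite ?mul0r ?mulr0.
by apply: finite_image; apply: finite_setX; exact: freemod_finite.
Qed.

Definition free_mul (f g : free_nalg) : free_nalg :=
  FreeMod (free_mul_finsupp f g).

Lemma free_mul_Leaf f g t : free_mul f g (Leaf t) = 0.
Proof. by []. Qed.

Lemma free_mul_Node f g l r : free_mul f g (Node l r) = f l * g r.
Proof. by []. Qed.

Lemma free_mul_linearl g : linear (free_mul^~ g).
Proof.
move=> a f f'; apply: freemodP => -[t|l r]; rewrite freemodE.
  by rewrite !free_mul_Leaf mulr0 addr0.
by rewrite !free_mul_Node freemodE mulrDl mulrA.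
Qed.

Lemma free_mul_linearr f : linear (free_mul f).
Proof.
move=> a g g'; apply: freemodP => -[t|l r]; rewrite freemodE.
  by rewrite !free_mul_Leaf mulr0 addr0.
by rewrite !free_mul_Node freemodE mulrDr mulrCA.
Qed.

HB.instance Definition _ := Lmodule_hasBilinearMul.Build K free_nalg
  free_mul_linearl free_mul_linearr.

Definition gen (t : T) : free_nalg := delta K (Leaf t).

Lemma delta_Node l r :
  delta K (Node l r) = (delta K l : free_nalg) ** delta K r.
Proof.
change (delta K (Node l r) = free_mul (delta K l) (delta K r)).
apply: freemodP => -[t|l' r']; rewrite ?free_mul_Leaf ?free_mul_Node !deltaE.
  by rewrite (_ : (_ == _) = false) //; apply/eqP.
rewrite -natrM mulnb; congr (_%:R); congr nat_of_bool.
by apply/eqP/andP => [[-> ->]|[/eqP -> /eqP ->]].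
Qed.

Context {A : nalgType K}.

Fixpoint magma_eval (phi : T -> A) (m : magma T) : A :=
  match m with
  | Leaf t => phi t
  | Node l r => magma_eval phi l ** magma_eval phi r
  end.

Definition free_nalg_lift (phi : T -> A) : free_nalg -> A :=
  freemod_lift (magma_eval phi).

Lemma free_nalg_lift_gen phi t : free_nalg_lift phi (gen t) = phi t.
Proof. exact: freemod_lift_delta. Qed.

Lemma free_nalg_lift_hom phi : nalg_hom (free_nalg_lift phi).
Proof.
have lF : linear (free_nalg_lift phi) := freemod_lift_linear _.
split=> // f g; move: f; apply: freemod_ext => [||l].
- exact: linear_comp lF (nmul_linearl g).
- exact: linear_comp (nmul_linearl _) lF.
move: g; apply: freemod_ext => [||r].
- exact: linear_comp lF (nmul_linearr _).
- exact: linear_comp (nmul_linearr _) lF.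
by rewrite -delta_Node /free_nalg_lift !freemod_lift_delta.
Qed.

Lemma free_nalg_ext (phi psi : free_nalg -> A) : nalg_hom phi -> nalg_hom psi ->
  (forall t, phi (gen t) = psi (gen t)) -> phi =1 psi.
Proof.
move=> [lphi mphi] [lpsi mpsi] E; apply: freemod_ext => //.
by elim=> [//|l IHl r IHr]; rewrite delta_Node mphi mpsi IHl IHr.
Qed.

End FreeNAlgebra.

Section Variety.
Context {K : comPzRingType} (I : set (free_nalg K nat)).

(* Homomorphisms from the free algebra are substitutions of the variables. *)
Definition in_variety (A : nalgType K) :=
  forall f, I f -> forall phi : free_nalg K nat -> A, nalg_hom phi -> phi f = 0.

(* The free algebra generated by a module M in the variety of I: generators
   from M, subject to linearity and to all values of the identities *)
Section FreeInVariety.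
Context (M : lmodType K).

Inductive FI_rel : set (free_nalg K M) :=
| FI_rel_linear a x y : FI_rel (gen K (a *: x + y) - (a *: gen K x + gen K y))
| FI_rel_identity f (phi : free_nalg K nat -> free_nalg K M) :
    I f -> nalg_hom phi -> FI_rel (phi f).

Definition FI := quotalg (ideal_gen FI_rel).
HB.instance Definition _ := NAlgebra.on FI.

Definition FI_j (x : M) : FI := quotalg_pi _ (gen K x).

Lemma FI_j_linear : linear FI_j.
Proof.
move=> a x y; rewrite /FI_j -quotpi_linear; apply/quotpi_eq.
by apply: sub_ideal_gen; apply: FI_rel_linear.
Qed.

Lemma FI_in_variety : in_variety FI.
Proof.
move=> f If psi hpsi.
pose phi := free_nalg_lift (fun n => repr (psi (gen K n)) : free_nalg K M).
have hphi : nalg_hom phi by exact: free_nalg_lift_hom.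
have hp := quotalg_pi_hom (ideal_gen FI_rel).
have -> : psi f = quotalg_pi (ideal_gen FI_rel) (phi f).
  apply: (free_nalg_ext hpsi (nalg_hom_comp hp hphi)) => n /=.
  by rewrite /phi free_nalg_lift_gen /quotalg_pi /quotpi reprK.
by apply: quotalg_pi0; apply: sub_ideal_gen; apply: FI_rel_identity.
Qed.

Lemma FI_ext (B : nalgType K) (f g : FI -> B) : nalg_hom f -> nalg_hom g ->
  (forall x, f (FI_j x) = g (FI_j x)) -> f =1 g.
Proof.
move=> hf hg fg u; have [w ->] := quotalg_surj u.
have hp := quotalg_pi_hom (ideal_gen FI_rel).
exact: (free_nalg_ext (nalg_hom_comp hf hp) (nalg_hom_comp hg hp) fg).
Qed.

Context {B : nalgType K}.

Definition FI_lift (phi : M -> B) : FI -> B := quot_lift (free_nalg_lift phi).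

Variables (phi : M -> B) (lphi : linear phi) (VB : in_variety B).

Let phi_rel : forall x, ideal_gen FI_rel x -> free_nalg_lift phi x = 0.
Proof.
have hF := free_nalg_lift_hom phi.
apply: (ideal_gen_sub (nalg_hom_kernel hF)) => _ [a x y|f rho If hrho] /=.
  by rewrite (linearD_of hF.1) hF.1 !free_nalg_lift_gen lphi subrr.
exact: (VB If (nalg_hom_comp hF hrho)).
Qed.

Lemma FI_lift_hom : nalg_hom (FI_lift phi).
Proof. exact: quotalg_lift_hom (free_nalg_lift_hom phi) phi_rel. Qed.

Lemma FI_lift_j x : FI_lift phi (FI_j x) = phi x.
Proof.
by rewrite /FI_lift (quotalg_liftE (free_nalg_lift_hom phi) phi_rel)
  free_nalg_lift_gen.
Qed.

End FreeInVariety.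

Theorem FI_universal (M : lmodType K) (B : nalgType K) (phi : M -> B) :
  linear phi -> in_variety B ->
  exists! phih : FI M -> B, nalg_hom phih /\ phih \o @FI_j M = phi.
Proof.
move=> lphi VB; exists (FI_lift phi); split.
  by split; [exact: FI_lift_hom|apply/funext => x; exact: FI_lift_j].
move=> f [hf fE]; apply/funext; apply: FI_ext => // [|x]; first exact: FI_lift_hom.
by rewrite FI_lift_j // -fE.
Qed.

End Variety.

Section PartialActions.
Context {K : comPzRingType} {G : groupType}.

Definition alg_iso_on (A B : nalgType K) (D : set A) (E : set B) (f : A -> B) :=
  [/\ set_bij D E f,
      forall a x y, D x -> D y -> f (a *: x + y) = a *: f x + f y &
      forall x y, D x -> D y -> f (x ** y) = f x ** f y].

(* The isomorphism from dom g^-1 to dom g is encoded as a total function act g,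
   whose values outside dom g^-1 are irrelevant. *)
Record partial_action (A : nalgType K) := PartialAction {
  dom : G -> set A;
  act : G -> A -> A;
  dom_subalgebra : forall g, subalgebra (dom g);
  act_iso : forall g, alg_iso_on (dom g^-1%g) (dom g) (act g);
  dom1 : dom 1%g = setT;
  act1 : forall x, act 1%g x = x;
  act_dom : forall g h,
    act g @` (dom g^-1%g `&` dom (g^-1 * h)%g) `<=` dom g `&` dom h;
  act_act : forall g h x, dom h^-1%g x -> dom (h^-1 * g^-1)%g x ->
    act g (act h x) = act (g * h)%g x
}.

Definition global_action (A : nalgType K) (alpha : partial_action A) :=
  forall g, dom alpha g = setT.

Definition equivariant (A B : nalgType K) (alpha : partial_action A)
    (beta : partial_action B) (phi : A -> B) :=
  [/\ nalg_hom phi,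
      forall g, phi @` dom alpha g `<=` dom beta g &
      forall g x, dom alpha g^-1%g x -> phi (act alpha g x) = act beta g (phi x)].

Definition universal_global_action (I : set (free_nalg K nat))
    (A B : nalgType K) (alpha : partial_action A) (theta : partial_action B)
    (nu : A -> B) :=
  [/\ in_variety I B, global_action theta, equivariant alpha theta nu &
      forall (X : nalgType K) (beta : partial_action X) (psi : A -> X),
        in_variety I X -> global_action beta -> equivariant alpha beta psi ->
        exists! psit : B -> X, equivariant theta beta psit /\ psit \o nu = psi].

Section GlobalAction.
Context {B : nalgType K} {t : G -> B -> B}.
Hypothesis t_hom : forall g, nalg_hom (t g).
Hypothesis t1 : forall x, t 1%g x = x.
Hypothesis tM : forall g h x, t g (t h x) = t (g * h)%g x.

Fact global_subalgebra (g : G) : subalgebra [set: B].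
Proof. by []. Qed.

Fact global_iso g : alg_iso_on [set: B] [set: B] (t g).
Proof.
have [lt mt] := t_hom g; split=> [|a x y _ _|x y _ _]; [|exact: lt|exact: mt].
split=> // [x y _ _ E|y _]; last by exists (t g^-1%g y); rewrite // tM mulgV t1.
by rewrite -(t1 x) -(t1 y) -(mulVg g) -!tM E.
Qed.

Fact global_dom (g h : G) : t g @` (setT `&` setT) `<=` setT `&` setT.
Proof. by []. Qed.

Definition global_of_action : partial_action B :=
  @PartialAction B (fun=> setT) t global_subalgebra global_iso erefl t1
    global_dom (fun g h x _ _ => tM g h x).

End GlobalAction.
End PartialActions.
Arguments partial_action {K} G A.

Section UniversalGlobalAction.
Context {K : comPzRingType} {G : groupType} (I : set (free_nalg K nat)).
Context {A : nalgType K} (alpha : partial_action G A).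

(* Of the group algebra, only the module structure is used *)
Definition group_alg := freemod K G.
HB.instance Definition _ := GRing.Lmodule.on group_alg.

Inductive Lambda_rel : set (tensor group_alg A) :=
| LambdaRel g h a : dom alpha h^-1%g a -> Lambda_rel
    (tens (delta K g : group_alg) (act alpha h a)
     - tens (delta K (g * h)%g : group_alg) a).

Definition Lambda := quotmod (submod_gen Lambda_rel).
HB.instance Definition _ := GRing.Lmodule.on Lambda.

Definition bracket (g : G) (a : A) : Lambda :=
  quotpi _ (tens (delta K g : group_alg) a).

Lemma bracket_linear g : linear (bracket g).
Proof. by move=> a x y; rewrite /bracket tens_linearr quotpi_linear. Qed.

Lemma bracket_act g h a : dom alpha h^-1%g a ->
  bracket g (act alpha h a) = bracket (g * h)%g a.
Proof.
by move=> ha; apply/quotpi_eq; apply: sub_submod_gen; apply: LambdaRel.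
Qed.

Lemma Lambda_ext (V : lmodType K) (f f' : Lambda -> V) :
  linear f -> linear f' ->
  (forall g a, f (bracket g a) = f' (bracket g a)) -> f =1 f'.
Proof.
move=> lf lf' E u; have [w ->] := quotpi_surj u.
have lp := quotpi_linear (submod_gen Lambda_rel).
move: w; apply: tensor_ext; [exact: linear_comp lf lp|exact: linear_comp lf' lp|].
move=> x a; move: x; apply: freemod_ext => [||g]; last exact: E.
  exact: (linear_comp (linear_comp lf lp) (tens_linearl a)).
exact: (linear_comp (linear_comp lf' lp) (tens_linearl a)).
Qed.

Definition Theta (g : G) : Lambda -> Lambda :=
  quot_lift (tensor_lift (fun (x : group_alg) a =>
    freemod_lift (fun h => bracket (g * h)%g a) x)).

Section ThetaTheory.
Variable g : G.
Let F (x : group_alg) a := freemod_lift (fun h => bracket (g * h)%g a) x.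

Let F_linearl a : linear (F^~ a).
Proof. exact: freemod_lift_linear. Qed.

Let F_linearr x : linear (F x).
Proof.
move=> c a b; move: x; apply: freemod_ext => [||h].
- exact: F_linearl.
- move=> d x y; rewrite !F_linearl !scalerDr !scalerA [c * d]mulrC.
  by rewrite addrACA.
- by rewrite /F !freemod_lift_delta bracket_linear.
Qed.

Let F_lift : linear (tensor_lift F).
Proof. exact: tensor_lift_linear. Qed.

Let F_rel x : submod_gen Lambda_rel x -> tensor_lift F x = 0.
Proof.
apply: (smallest_sub (linear_kernel_submodule F_lift)) => _ [k h a ha] /=.
rewrite (linearD_of F_lift) !tensor_lift_tens // /F !freemod_lift_delta.
by rewrite bracket_act // mulgA subrr.
Qed.

Lemma Theta_linear : linear (Theta g).
Proof. exact: quot_lift_linear F_lift F_rel. Qed.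

Lemma Theta_bracket h a : Theta g (bracket h a) = bracket (g * h)%g a.
Proof.
by rewrite /Theta (quot_liftE F_lift F_rel) tensor_lift_tens // /F
  freemod_lift_delta.
Qed.

End ThetaTheory.

Definition Lambda_iota (a : A) : Lambda := bracket 1%g a.

Definition FLambda := FI I Lambda.
HB.instance Definition _ := NAlgebra.on FLambda.

Definition FLambda_j : Lambda -> FLambda := @FI_j K I Lambda.

Definition Thetat (g : G) : FLambda -> FLambda := FI_lift (FLambda_j \o Theta g).

Lemma Thetat_hom g : nalg_hom (Thetat g).
Proof.
apply: FI_lift_hom (@FI_in_variety K I Lambda).
exact: (linear_comp (@FI_j_linear K I Lambda) (Theta_linear g)).
Qed.

Lemma Thetat_FLambda_j g x : Thetat g (FLambda_j x) = FLambda_j (Theta g x).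
Proof.
apply: (FI_lift_j _ (@FI_in_variety K I Lambda)).
exact: (linear_comp (@FI_j_linear K I Lambda) (Theta_linear g)).
Qed.

Lemma Thetat1 x : Thetat 1%g x = x.
Proof.
move: x; apply: FI_ext => [||x]; [exact: Thetat_hom|by []|].
rewrite Thetat_FLambda_j; congr FLambda_j; move: x; apply: Lambda_ext => [||g a].
- exact: Theta_linear.
- by [].
- by rewrite Theta_bracket mul1g.
Qed.

Lemma ThetatM g h x : Thetat g (Thetat h x) = Thetat (g * h)%g x.
Proof.
move: x; apply: FI_ext => [||x].
- exact: (nalg_hom_comp (Thetat_hom g) (Thetat_hom h)).
- exact: Thetat_hom.
rewrite !Thetat_FLambda_j; congr FLambda_j; move: x; apply: Lambda_ext => [||k a].
- exact: (linear_comp (Theta_linear g) (Theta_linear h)).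
- exact: Theta_linear.
- by rewrite !Theta_bracket mulgA.
Qed.

Definition Theta_action : partial_action G FLambda :=
  global_of_action Thetat_hom Thetat1 ThetatM.

Inductive Omega_rel : set FLambda :=
| OmegaRel g a b :
    Omega_rel (FLambda_j (bracket g a) ** FLambda_j (bracket g b)
               - FLambda_j (bracket g (a ** b))).

Definition Omega_ideal : ideal FLambda := ideal_gen Omega_rel.

Lemma Omega_ideal_invariant g x : Omega_ideal x -> Omega_ideal (Thetat g x).
Proof.
have [lT mT] := Thetat_hom g.
have [[J0 JL] JM] := idealP Omega_ideal.
apply: (@ideal_gen_sub _ _ Omega_rel [set x | Omega_ideal (Thetat g x)]).
  split; first split=> [|a y z Jy Jz] /=.
  - by rewrite (linear0_of lT); exact: J0.
  - by rewrite lT; exact: JL.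
  - by move=> y z Jy; rewrite /= !mT; exact: JM.
move=> _ [h a b] /=; rewrite (linearD_of lT) mT !Thetat_FLambda_j !Theta_bracket.
by apply: sub_ideal_gen; apply: OmegaRel.
Qed.

Definition Omega := quotalg Omega_ideal.
HB.instance Definition _ := NAlgebra.on Omega.

Definition Omega_pi : FLambda -> Omega := quotalg_pi Omega_ideal.

Lemma Omega_pi_surj (u : Omega) : exists x, u = Omega_pi x.
Proof. exact: quotalg_surj. Qed.

Definition theta_act (g : G) : Omega -> Omega :=
  quot_lift (Omega_pi \o Thetat g).

Lemma Omega_pi_Thetat_hom g : nalg_hom (Omega_pi \o Thetat g).
Proof. exact: (nalg_hom_comp (quotalg_pi_hom Omega_ideal) (Thetat_hom g)). Qed.

Lemma Omega_pi_Thetat_ideal g x : Omega_ideal x -> (Omega_pi \o Thetat g) x = 0.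
Proof. by move=> Jx; apply: quotalg_pi0; apply: Omega_ideal_invariant. Qed.

Lemma theta_act_hom g : nalg_hom (theta_act g).
Proof.
exact: quotalg_lift_hom (Omega_pi_Thetat_hom g) (Omega_pi_Thetat_ideal g).
Qed.

Lemma theta_act_Omega_pi g x : theta_act g (Omega_pi x) = Omega_pi (Thetat g x).
Proof.
exact: (quotalg_liftE (Omega_pi_Thetat_hom g) (Omega_pi_Thetat_ideal g)).
Qed.

Lemma theta_act1 x : theta_act 1%g x = x.
Proof. by have [y ->] := Omega_pi_surj x; rewrite theta_act_Omega_pi Thetat1. Qed.

Lemma theta_actM g h x : theta_act g (theta_act h x) = theta_act (g * h)%g x.
Proof.
by have [y ->] := Omega_pi_surj x; rewrite !theta_act_Omega_pi ThetatM.
Qed.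

Definition theta : partial_action G Omega :=
  global_of_action theta_act_hom theta_act1 theta_actM.

Definition nu (a : A) : Omega := Omega_pi (FLambda_j (Lambda_iota a)).

End UniversalGlobalAction.
Arguments group_alg K G : clear implicits.

(* Main.v *)
Require Import Defs.
From HB Require Import structures.
From mathcomp Require Import all_boot all_algebra.
From mathcomp Require Import finmap boolp classical_sets functions cardinality fsbigop.

(** The algebra Omega is generated by the elements [omega_gen g a], the images
    of the brackets, and its defining relations also hold between
    the elements beta_g (psi a) of any global action beta receiving an
    equivariant map psi from alpha:
    - linearity in a, because psi and beta_g are linear;
    - [g, alpha_h a] = [gh, a], because psi (alpha_h a) = beta_h (psi a)
      and beta_g beta_h = beta_gh;
    - [g, a] [g, b] = [g, ab], because beta_g and psi are multiplicative;
    - the identities of the variety, because they hold in X.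
    Hence [g, a] |-> beta_g (psi a) extends to a homomorphism from Omega to X
    ([Lambda_lift] handles the relations that only involve the module
    structure, [Omega_lift] the remaining ones).
    It commutes with the actions since theta_h [g, a] = [hg, a] is sent to
    beta_hg (psi a) = beta_h (beta_g (psi a)), and it extends psi since
    nu a = [1, a].  Conversely [g, a] = theta_g (nu a), so an equivariant map
    extending psi has no other choice on the generators, which gives
    uniqueness by [Omega_ext]. *)

Section UniversalProperty.
Import GRing.Theory.
Local Open Scope classical_set_scope.
Local Open Scope ring_scope.

(** A homomorphism from a free algebra into a quotient lifts to the algebra
    itself, so that any identity of the algebra passes to the quotient. *)
Lemma quotalg_in_variety {K : comPzRingType} (I : set (free_nalg K nat))
    {B : nalgType K} (J : ideal B) :
  in_variety I B -> in_variety I (quotalg J).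
Proof.
move=> VB f If phi hphi.
pose lift : free_nalg K nat -> B := free_nalg_lift (fun n => repr (phi (gen K n))).
have hlift : nalg_hom lift by exact: free_nalg_lift_hom.
have -> : phi f = quotalg_pi J (lift f).
  apply: (free_nalg_ext hphi (nalg_hom_comp (quotalg_pi_hom J) hlift)) => n /=.
  by rewrite /lift free_nalg_lift_gen /quotalg_pi /quotpi reprK.
by rewrite (VB f If lift hlift); apply: (linear0_of (quotpi_linear _)).
Qed.

Section GlobalActionTheory.
Context {K : comPzRingType} {G : groupType} {X : nalgType K}.
Context {beta : partial_action G X} (gbeta : global_action beta).

Lemma global_act_hom g : nalg_hom (act beta g).
Proof.
have [_ lin mul] := act_iso beta g.
by split=> [a x y|x y]; [apply: lin|apply: mul]; rewrite gbeta.
Qed.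

Lemma global_actM g h x : act beta g (act beta h x) = act beta (g * h)%g x.
Proof. by apply: act_act; rewrite gbeta. Qed.

End GlobalActionTheory.

Section Generators.
Context {K : comPzRingType} {G : groupType} (I : set (free_nalg K nat)).
Context {A : nalgType K} (alpha : partial_action G A).

Section LambdaLift.
Context {V : lmodType K} (f : G -> A -> V).
Hypothesis f_linear : forall g, linear (f g).
Hypothesis f_act : forall g h a,
  dom alpha h^-1%g a -> f g (act alpha h a) = f (g * h)%g a.

Let tf (x : group_alg K G) (a : A) : V := freemod_lift (f^~ a) x.

Let tf_linearl a : linear (tf^~ a).
Proof. exact: freemod_lift_linear. Qed.

Let tf_linearr x : linear (tf x).
Proof.
(* The condition is linear in x, hence need only be checked on group
   elements *)
move=> c a b; move: x; apply: freemod_ext => [||h].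
- exact: tf_linearl.
- move=> d x y; rewrite !tf_linearl !scalerDr !scalerA [c * d]mulrC.
  by rewrite addrACA.
- by rewrite /tf !freemod_lift_delta f_linear.
Qed.

Let lift_linear : linear (tensor_lift tf).
Proof. exact: tensor_lift_linear. Qed.

Let lift_rel x : submod_gen (Lambda_rel alpha) x -> tensor_lift tf x = 0.
Proof.
apply: (smallest_sub (linear_kernel_submodule lift_linear)) => _ [k h a ha] /=.
rewrite (linearD_of lift_linear) !tensor_lift_tens // /tf !freemod_lift_delta.
by rewrite f_act // subrr.
Qed.

(** Existence half of the universal property of Lambda: linearity in the group
    algebra is automatic since group elements form a basis, and [f_act] is the
    image of the defining relations. *)
Lemma Lambda_lift : exists2 F : Lambda alpha -> V,
  linear F & forall g a, F (bracket alpha g a) = f g a.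
Proof.
exists (quot_lift (tensor_lift tf)).
  exact: quot_lift_linear lift_linear lift_rel.
move=> g a; rewrite /bracket (quot_liftE lift_linear lift_rel).
by rewrite tensor_lift_tens // /tf freemod_lift_delta.
Qed.

End LambdaLift.

Definition omega_gen (g : G) (a : A) : Omega I alpha :=
  Omega_pi (FLambda_j I (bracket alpha g a)).

Lemma omega_gen_linear g : linear (omega_gen g).
Proof.
have lj := linear_comp (@FI_j_linear K I (Lambda alpha)) (bracket_linear alpha g).
exact: (linear_comp (quotpi_linear (Omega_ideal I alpha)) lj).
Qed.

Lemma omega_genM g a b : omega_gen g (a ** b) = omega_gen g a ** omega_gen g b.
Proof.
rewrite -(quotalg_pi_hom (Omega_ideal I alpha)).2; apply/esym/quotpi_eq.
by apply: sub_ideal_gen; apply: OmegaRel.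
Qed.

Lemma theta_omega_gen g h a :
  act (theta I alpha) g (omega_gen h a) = omega_gen (g * h)%g a.
Proof.
by rewrite /= /omega_gen theta_act_Omega_pi Thetat_FLambda_j Theta_bracket.
Qed.

Lemma omega_gen_nu g a : omega_gen g a = act (theta I alpha) g (nu I alpha a).
Proof. by rewrite (theta_omega_gen g 1%g) mulg1. Qed.

Lemma Omega_ext {X : nalgType K} (f f' : Omega I alpha -> X) :
  nalg_hom f -> nalg_hom f' ->
  (forall g a, f (omega_gen g a) = f' (omega_gen g a)) -> f =1 f'.
Proof.
move=> hf hf' E u; have [x ->] := Omega_pi_surj u.
have hp := quotalg_pi_hom (Omega_ideal I alpha).
have lj := @FI_j_linear K I (Lambda alpha).
have hfp := nalg_hom_comp hf hp; have hfp' := nalg_hom_comp hf' hp.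
move: x; apply: (FI_ext hfp hfp') => x; move: x.
exact: (Lambda_ext (linear_comp hfp.1 lj) (linear_comp hfp'.1 lj)).
Qed.

Lemma Omega_in_variety : in_variety I (Omega I alpha).
Proof. exact/quotalg_in_variety/FI_in_variety. Qed.

(** Only products of two generators with the same group component are
    constrained in Omega, so it suffices that each f g be a homomorphism. *)
Lemma Omega_lift {X : nalgType K} (f : G -> A -> X) :
  in_variety I X -> (forall g, nalg_hom (f g)) ->
  (forall g h a, dom alpha h^-1%g a -> f g (act alpha h a) = f (g * h)%g a) ->
  exists2 F : Omega I alpha -> X,
    nalg_hom F & forall g a, F (omega_gen g a) = f g a.
Proof.
move=> VX f_hom f_act.
have [F lF FE] := Lambda_lift f (fun g => (f_hom g).1) f_act.
pose F1 : FLambda I alpha -> X := FI_lift F.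
have hF1 : nalg_hom F1 := FI_lift_hom lF VX.
have F1j x : F1 (FLambda_j I x) = F x by exact: FI_lift_j.
have F1_rel x : Omega_ideal I alpha x -> F1 x = 0.
  apply: (ideal_gen_sub (nalg_hom_kernel hF1)) => _ [g a b] /=.
  by rewrite (linearD_of hF1.1) hF1.2 !F1j !FE (f_hom g).2 subrr.
exists (quot_lift F1); first exact: quotalg_lift_hom hF1 F1_rel.
by move=> g a; rewrite [LHS](quotalg_liftE hF1 F1_rel) F1j FE.
Qed.

Lemma nu_equivariant : equivariant alpha (theta I alpha) (nu I alpha).
Proof.
split=> // [|g a ga].
  by split; [exact: (omega_gen_linear 1%g)|exact: (omega_genM 1%g)].
by rewrite -omega_gen_nu /nu /Lambda_iota bracket_act // mul1g.
Qed.

End Generators.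
End UniversalProperty.

Theorem theorem2p13 (K : comPzRingType) (G : groupType)
    (I : set (free_nalg K nat)) (A : nalgType K) (HA : in_variety I A)
    (alpha : partial_action G A) :
  universal_global_action I alpha (theta I alpha) (nu I alpha).
Proof.
split=> //; [exact: Omega_in_variety|exact: nu_equivariant|].
move=> X beta psi VX gbeta [hpsi _ psi_act].
pose f g a := act beta g (psi a).
have f_hom g : nalg_hom (f g) := nalg_hom_comp (global_act_hom gbeta g) hpsi.
have f_act g h a : dom alpha (h^-1)%g a ->
    f g (act alpha h a) = f (g * h)%g a.
  by move=> ha; rewrite /f psi_act // global_actM.
have [F hF FE] := Omega_lift I alpha f VX f_hom f_act.
exists F; split; first split.
- split=> // [g x _|g x _]; first by rewrite gbeta.
  move: x; apply: (@Omega_ext _ _ I _ alpha X).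
  + exact: (nalg_hom_comp hF (theta_act_hom I alpha g)).
  + exact: (nalg_hom_comp (global_act_hom gbeta g) hF).
  + by move=> h a; rewrite theta_omega_gen !FE /f global_actM.
- by apply/funext => a; rewrite /= (FE 1%g a) /f act1.
move=> F' [[hF' _ F'act] F'nu]; apply/funext; apply: Omega_ext => // g a.
by rewrite FE /f omega_gen_nu F'act // -[psi]F'nu.
Qed.
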